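(* Each semitopological $V$-semilattice $X$ satisfying the separation axiom $T_1$ is $w^\bullet$-Hausdorff, i.e. its weak$^\bullet$ topology $w^\bullet_X$ is Hausdorff.
   Context: A semilattice is a commutative semigroup of idempotents, ordered by $x\le y$ iff $xy=x$; ${\uparrow}x=\{y\in X:x\le y\}$, ${\downarrow}x=\{y\in X:y\le x\}$. A semitopological semilattice is a semilattice with a topology for which the operation $(x,y)\mapsto xy$ is separately continuous. $X$ is a $V$-semilattice if for any points $x\not\le y$ in $X$ there is a point $v\notin{\downarrow}y$ in $X$ such that ${\uparrow}v$ contains $x$ in its interior in $X$. The weak$^\bullet$ topology $w^\bullet_X$ is generated by the subbase of complements to closed subsemilattices of $X$. *)

(* Defs.v *)
From HB Require Import structures.
From mathcomp Require Import all_boot.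
From mathcomp Require Import all_classical topology.

Set Implicit Arguments.
Unset Strict Implicit.
Unset Printing Implicit Defensive.

Local Open Scope group_scope.
Local Open Scope classical_set_scope.

HB.mixin Record Semigroup_isSemilattice X of Semigroup X := {
  semilattice_mulC : forall x y : X, x * y = y * x;
  semilattice_mulxx : forall x : X, x * x = x;
}.

#[short(type="semilatticeType")]
HB.structure Definition Semilattice :=
  { X of Semigroup X & Semigroup_isSemilattice X }.

HB.structure Definition TopologicalSemilattice :=
  { X of Topological X & Semilattice X }.

HB.mixin Record TopologicalSemilattice_isSemitopological X
    of TopologicalSemilattice X := {
  mull_continuous : forall a : X, continuous (fun x : X => a * x);
  mulr_continuous : forall a : X, continuous (fun x : X => x * a);
}.

#[short(type="semitopologicalSemilatticeType")]
HB.structure Definition SemitopologicalSemilattice :=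
  { X of TopologicalSemilattice X & TopologicalSemilattice_isSemitopological X }.

Definition semilattice_le (X : semilatticeType) (x y : X) : Prop := x * y = x.

Definition upset (X : semilatticeType) (x : X) : set X :=
  [set y | semilattice_le x y].

Definition downset (X : semilatticeType) (x : X) : set X :=
  [set y | semilattice_le y x].

Definition V_semilattice (X : semitopologicalSemilatticeType) : Prop :=
  forall x y : X, ~ semilattice_le x y ->
    exists2 v : X, ~ downset y v & interior (upset v) x.

(* The empty set counts as a subsemilattice; its complement is the whole space,
   so this convention does not affect the weak topology below. *)
Definition subsemilattice (X : semilatticeType) (A : set X) : Prop :=
  forall x y : X, A x -> A y -> A (x * y).

(* An alias of X, so that the weak topology does not clash with the original
   one. *)
Definition weak_bullet (X : semitopologicalSemilatticeType) : Type := X.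

Section weak_bullet_topology.
Context (X : semitopologicalSemilatticeType).

HB.instance Definition _ := Choice.on (weak_bullet X).
HB.instance Definition _ := isSubBaseTopological.Build (weak_bullet X)
  [set F : set X | closed F /\ subsemilattice F] (fun F => ~` F).

End weak_bullet_topology.

(* Main.v *)
Require Import Defs.
From mathcomp Require Import all_boot.
From mathcomp Require Import all_classical topology.

(** Two points are separated in the weak topology as soon as the whole space is
    the union of two closed subsemilattices, each missing one of the points:
    the complements are then disjoint basic open sets.

    Distinct points [x], [y] satisfy [x </= y] or [y </= x], so by symmetry let
    [x </= y] and take [v] from the V-property: [v </= y], and [x] is interior
    to [upset v]. The two pieces of the cover are [upset v], which misses [y],
    and the closure of its complement, which misses [x]. The first is closed
    because it is the preimage of the point [v] under the translation by [v],
    and points are closed. The second is a subsemilattice because [upset v] is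
    a filter: its complement absorbs products, and separate continuity passes
    this absorption to the closure ([closure_ideal]). *)

Local Open Scope group_scope.
Local Open Scope classical_set_scope.

Lemma semilattice_le_anti (X : semilatticeType) (x y : X) :
  semilattice_le x y -> semilattice_le y x -> x = y.
Proof. by move=> xy yx; rewrite -[x]xy semilattice_mulC. Qed.

Lemma subsemilattice_upset (X : semilatticeType) (v : X) :
  subsemilattice (upset v).
Proof. by move=> x y vx vy; rewrite /upset /= /semilattice_le mulgA vx. Qed.

(** Since [x * z <= x], having [v <= x * z] would force [v <= x]. *)
Lemma setC_upset_ideal (X : semilatticeType) (v x z : X) :
  (~` upset v) x -> (~` upset v) (x * z).
Proof.
apply: contra_not => vxz; rewrite /upset /= /semilattice_le -vxz.
by rewrite -!mulgA [z * x]semilattice_mulC [x * (x * z)]mulgA semilattice_mulxx.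
Qed.

Lemma closed_upset (X : semitopologicalSemilatticeType) (v : X) :
  accessible_space X -> closed (upset v).
Proof.
move=> /accessible_closed_set1 /(_ v).
by have /continuous_closedP := @mull_continuous X v; apply.
Qed.

(** A translation mapping [A] into itself maps the closure of [A] into itself.
    When [A] is an ideal this applies to every [z], in particular to every [z]
    in the closure, so one use of continuity gives that the closure is a
    subsemilattice. *)
Lemma closure_ideal (X : semitopologicalSemilatticeType) (A : set X) (z : X) :
  (forall x, A x -> A (x * z)) -> forall x, closure A x -> closure A (x * z).
Proof.
move=> Az x clAx B /(mulr_continuous z) /clAx [y [Ay Byz]].
by exists (y * z); split=> //; exact: Az.
Qed.

Lemma open_weak_bullet (X : semitopologicalSemilatticeType) (F : set X) :
  closed F -> subsemilattice F -> open (~` F : set (weak_bullet X)).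
Proof.
move=> clF sF; exists [set ~` F]; last by rewrite bigcup_set1.
by move=> _ ->; exact: finI_from1.
Qed.

Lemma V_semilattice_cover (X : semitopologicalSemilatticeType) (x y : X) :
  V_semilattice X -> accessible_space X -> ~ semilattice_le x y ->
  exists F G : set X,
    [/\ closed F /\ subsemilattice F, closed G /\ subsemilattice G,
        ~ F x, ~ G y & F `|` G = setT].
Proof.
move=> VX T1 /VX [v vy vx]; exists (closure (~` upset v)), (upset v); split.
- split; first exact: closed_closure.
  move=> a b cla _; apply: closure_ideal cla => c; exact: setC_upset_ideal.
- by split; [exact: closed_upset | exact: subsemilattice_upset].
- by rewrite closure_setC => /(_ vx).
- by [].
- apply/seteqP; split=> // z _.
  by have [|nvz] := pselect (upset v z); [right | left; exact: subset_closure].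
Qed.

Lemma weak_bullet_separation (X : semitopologicalSemilatticeType) (x y : X) :
  V_semilattice X -> accessible_space X -> ~ semilattice_le x y ->
  exists U V : set (weak_bullet X),
    [/\ open U, open V, U x, V y & U `&` V = set0].
Proof.
move=> VX T1 nxy.
have [F [G [[clF sF] [clG sG] nFx nGy FG]]] := V_semilattice_cover _ _ _ VX T1 nxy.
exists (~` F), (~` G); split=> //; [exact: open_weak_bullet..|].
by rewrite -setCU FG setCT.
Qed.

Theorem proposition6p4 (X : semitopologicalSemilatticeType) :
  V_semilattice X -> accessible_space X -> hausdorff_space (weak_bullet X).
Proof.
move=> VX T1; rewrite open_hausdorff => x y /eqP xy.
have [lexy|nxy] := pselect (semilattice_le (x : X) y); last first.
  have [U [V [oU oV Ux Vy UV]]] := weak_bullet_separation _ _ _ VX T1 nxy.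
  by exists (U, V); split=> //=; [exact: mem_set..|apply/eqP].
have nyx : ~ semilattice_le (y : X) x.
  by move=> leyx; apply: xy; exact: (@semilattice_le_anti X).
have [U [V [oU oV Uy Vx UV]]] := weak_bullet_separation _ _ _ VX T1 nyx.
by exists (V, U); split=> //=; [exact: mem_set..|rewrite setIC; apply/eqP].
Qed.
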